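(* Let $\Theta<0$ and, for $\mu\ge 0$, let $$f_\mu(x)=\left(\frac{1-e^{-\mu}}{1+e^{-\mu}}\,x+1-\frac{2}{1+e^{-\mu x}}\right)\Theta,\qquad x\in[0,1].$$ Let $\mu_0=0$ and let $\mu_1>0$ be chosen such that $f_{\mu_1}(c)=1$, where $c\in(0,1)$ is the critical point of $f_{\mu_1}$. Then $(f_\mu)_{\mu\in[\mu_0,\mu_1]}$ is a full family of S-unimodal maps on $[0,1]$.
   Context: Let $I=[0,1]$. Unimodal map: $f:I\to I$ is unimodal if $f(0)=f(1)=0$ and $f$ has a unique critical point $c$ (i.e. $f'(c)=0$), with $0<c<1$. Schwarzian derivative: $Sf(x)=\dfrac{f'''(x)}{f'(x)}-\dfrac32\left(\dfrac{f''(x)}{f'(x)}\right)^2$ (at points where $f'(x)\neq0$). Itinerary: for $x\in I$, the itinerary of $x$ under $f$ is the infinite sequence $\mathcal{S}(x)=(s_0s_1s_2\dots)$ with $s_j=0$ if $f^j(x)<c$, $s_j=1$ if $f^j(x)>c$, $s_j=C$ if $f^j(x)=c$, where $f^j$ is the $j$-th iterate. The kneading sequence is $K(f)=\mathcal{S}(f(c))$. Full family of S-unimodal maps: a family $f_\mu$, $\mu_0\le\mu\le\mu_1$, of maps of $I$, unimodal for $\mu_0<\mu\le\mu_1$, such that (1) $f_{\mu_0}(x)=0$ for all $x\in I$; (2) $K(f_{\mu_1})=(1000\dots)$, a $1$ followed by all $0$s; (3) $Sf_\mu(x)<0$ for all $\mu\in(\mu_0,\mu_1]$ and all $x\in I$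 (with $f_\mu'(x)\ne0$). *)

(* Defs.v *)
From Stdlib Require Import Reals.
Open Scope R_scope.

Definition I01 (x : R) : Prop := 0 <= x <= 1.

Definition maps_I (f : R -> R) : Prop := forall x, I01 x -> I01 (f x).

(** A map of I is given by a total function on R of which only the values on I
    matter: all derivatives are taken relative to I with [D_in], hence they are
    one-sided at 0 and 1.  [D_in f d I01 x] only reads the value [d x]. *)
Definition differentiable_I (f : R -> R) : Prop :=
  forall x, I01 x -> exists l, D_in f (fun _ => l) I01 x.

Definition critical_point (f : R -> R) (c : R) : Prop :=
  I01 c /\ D_in f (fun _ => 0) I01 c.

Definition unimodal (f : R -> R) : Prop :=
  maps_I f /\ differentiable_I f /\ f 0 = 0 /\ f 1 = 0 /\
  exists c, 0 < c < 1 /\ critical_point f c /\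
            forall c', critical_point f c' -> c' = c.

Definition schwarzian (d1 d2 d3 : R -> R) (x : R) : R :=
  d3 x / d1 x - 3 / 2 * (d2 x / d1 x) ^ 2.

(** The derivatives [d1], [d2], [d3] are determined on I by [f], since I has
    no isolated points. *)
Definition negative_schwarzian (f : R -> R) : Prop :=
  exists d1 d2 d3 : R -> R,
    (forall x, I01 x -> D_in f d1 I01 x) /\
    (forall x, I01 x -> D_in d1 d2 I01 x) /\
    (forall x, I01 x -> D_in d2 d3 I01 x) /\
    (forall x, I01 x -> d1 x <> 0 -> schwarzian d1 d2 d3 x < 0).

Inductive symbol : Set := Sym0 | Sym1 | SymC.

Definition itinerary (f : R -> R) (c x : R) (j : nat) : symbol :=
  let y := Nat.iter j f x in
  if Rlt_dec y c then Sym0 else if Rlt_dec c y then Sym1 else SymC.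

(** [c] is meant to be the critical point of [f]. *)
Definition kneading (f : R -> R) (c : R) : nat -> symbol :=
  itinerary f c (f c).

Definition one_then_zeros (j : nat) : symbol :=
  match j with O => Sym1 | S _ => Sym0 end.

Definition full_S_unimodal_family (f : R -> R -> R) (mu0 mu1 : R) : Prop :=
  mu0 < mu1 /\
  (forall mu, mu0 <= mu <= mu1 -> maps_I (f mu)) /\
  (forall mu, mu0 < mu <= mu1 -> unimodal (f mu)) /\
  (forall x, I01 x -> f mu0 x = 0) /\
  (forall c, critical_point (f mu1) c ->
     forall j, kneading (f mu1) c j = one_then_zeros j) /\
  (forall mu, mu0 < mu <= mu1 -> negative_schwarzian (f mu)).

Definition fmu (Theta mu x : R) : R :=
  ((1 - exp (- mu)) / (1 + exp (- mu)) * x + 1 - 2 / (1 + exp (- mu * x)))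
  * Theta.

(* Main.v *)
Require Import Defs.
From Stdlib Require Import Reals.
From Stdlib Require Import Lra.
From Coquelicot Require Import Coquelicot.
Open Scope R_scope.

(** With [g y = tanh (y / 2)] one has [f_mu x = - Theta * (g (mu x) - x g mu)]
    and [g' = (1 - g^2) / 2].  Hence [f_mu'] is strictly decreasing on [I], and
    for fixed [x] in [I] the value [f_mu x] is nondecreasing in [mu], so that
    [0 = f_0 x <= f_mu x <= f_mu1 x <= f_mu1 c = 1].  The sign of the
    Schwarzian is that of [-((1 - k) + (3 k - 1) t^2)] with [t = g (mu x)] and
    [k = 2 g mu / mu] in [(0, 1)]; the bracket is affine in [t^2], equal to
    [1 - k > 0] at [0] and to [2 k > 0] at [1]. *)

(** * The rescaled hyperbolic tangent [g] *)

Definition g (y : R) : R := 2 / (1 + exp (- y)) - 1.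

Lemma g_0 : g 0 = 0.
Proof. unfold g. rewrite Ropp_0, exp_0. field. Qed.

Lemma g_gt_m1 (y : R) : -1 < g y.
Proof.
  unfold g. pose proof (exp_pos (- y)).
  assert (0 < 2 / (1 + exp (- y))) by (apply Rdiv_lt_0_compat; lra). lra.
Qed.

Lemma g_lt_1 (y : R) : g y < 1.
Proof.
  unfold g. pose proof (exp_pos (- y)).
  assert (2 / (1 + exp (- y)) < 2); [|lra].
  apply Rlt_div_l; nra.
Qed.

Lemma is_derive_g (y : R) : is_derive g y ((1 - g y ^ 2) / 2).
Proof.
  unfold g. pose proof (exp_pos (- y)).
  auto_derive; [lra | field; lra].
Qed.

Lemma Derive_g (y : R) : Derive g y = (1 - g y ^ 2) / 2.
Proof. apply is_derive_unique, is_derive_g. Qed.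

Lemma ex_derive_g (y : R) : ex_derive g y.
Proof. eexists; apply is_derive_g. Qed.

Lemma g_increasing (x y : R) : x < y -> g x < g y.
Proof.
  intros Hxy.
  destruct (MVT_cor2 g (fun z => (1 - g z ^ 2) / 2) x y Hxy) as [z [Hz _]].
  { intros z _. apply is_derive_Reals, is_derive_g. }
  pose proof (g_gt_m1 z). pose proof (g_lt_1 z).
  assert (0 < (1 - g z ^ 2) / 2 * (y - x)) by (apply Rmult_lt_0_compat; nra).
  lra.
Qed.

Lemma g_nondecreasing (x y : R) : x <= y -> g x <= g y.
Proof.
  intros [H | ->]; [left; apply g_increasing; exact H | right; reflexivity].
Qed.

Lemma g_pos (y : R) : 0 < y -> 0 < g y.
Proof. intros H. rewrite <- g_0. apply g_increasing; exact H. Qed.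

Lemma g_nonneg (y : R) : 0 <= y -> 0 <= g y.
Proof. intros H. rewrite <- g_0. apply g_nondecreasing; exact H. Qed.

(** The slope of [g] is below 1/2 away from 0. At [y = mu] this is the bound that makes the
    Schwarzian negative. *)
Lemma g_lt_half (y : R) : 0 < y -> g y < y / 2.
Proof.
  intros Hy.
  destruct (MVT_cor2 g (fun z => (1 - g z ^ 2) / 2) 0 y Hy) as [z [Hz [Hz0 _]]].
  { intros z _. apply is_derive_Reals, is_derive_g. }
  rewrite g_0 in Hz. pose proof (g_pos z Hz0).
  assert (0 < g z ^ 2 * y) by (apply Rmult_lt_0_compat; nra).
  lra.
Qed.

(** * The family in terms of [g] and its derivatives in [x] *)

Lemma fmu_g (Theta mu x : R) :
  fmu Theta mu x = - Theta * (g (mu * x) - x * g mu).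
Proof.
  (* The exponent reads [(- mu) * x] in [fmu] but [- (mu * x)] in [g]; both must agree before
     [field]. *)
  unfold fmu, g. rewrite Ropp_mult_distr_l.
  pose proof (exp_pos (- mu)). pose proof (exp_pos (- mu * x)).
  field; lra.
Qed.

(** Written as polynomials in [g (mu * x)], the derivatives reduce the Schwarzian inequality to
    algebra. *)
Definition fmu_d1 (Theta mu x : R) : R :=
  - Theta * (mu * (1 - g (mu * x) ^ 2) / 2 - g mu).

Definition fmu_d2 (Theta mu x : R) : R :=
  Theta * mu ^ 2 / 2 * g (mu * x) * (1 - g (mu * x) ^ 2).

Definition fmu_d3 (Theta mu x : R) : R :=
  Theta * mu ^ 3 / 4 * (1 - g (mu * x) ^ 2) * (1 - 3 * g (mu * x) ^ 2).

Lemma is_derive_fmu (Theta mu x : R) :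
  is_derive (fmu Theta mu) x (fmu_d1 Theta mu x).
Proof.
  apply is_derive_ext with (fun x => - Theta * (g (mu * x) - x * g mu)).
  { intros t. symmetry. apply fmu_g. }
  unfold fmu_d1.
  auto_derive; [repeat split; apply ex_derive_g | rewrite Derive_g; field].
Qed.

Lemma is_derive_fmu_d1 (Theta mu x : R) :
  is_derive (fmu_d1 Theta mu) x (fmu_d2 Theta mu x).
Proof.
  unfold fmu_d1, fmu_d2.
  auto_derive; [repeat split; apply ex_derive_g | rewrite Derive_g; field].
Qed.

Lemma is_derive_fmu_d2 (Theta mu x : R) :
  is_derive (fmu_d2 Theta mu) x (fmu_d3 Theta mu x).
Proof.
  unfold fmu_d2, fmu_d3.
  auto_derive; [repeat split; apply ex_derive_g | rewrite Derive_g; field].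
Qed.

(** * Derivatives relative to [I] *)

Lemma is_derive_D_in (f d : R -> R) (D : R -> Prop) (x : R) :
  is_derive f x (d x) -> D_in f d D x.
Proof.
  intros H. apply D_in_imp with no_cond; [intros y _; exact I|].
  apply derivable_pt_lim_D_in, is_derive_Reals, H.
Qed.

Lemma adhDa_I01 (x : R) : I01 x -> adhDa (D_x I01 x) x.
Proof.
  intros [H0 H1] e He.
  pose proof (Rmin_l (e / 2) (1 / 2)). pose proof (Rmin_r (e / 2) (1 / 2)).
  assert (0 < Rmin (e / 2) (1 / 2)) by (apply Rmin_glb_lt; lra).
  set (h := Rmin (e / 2) (1 / 2)) in *.
  (* A step of length at most 1/2 towards the farther endpoint stays in [I]. *)
  destruct (Rle_lt_dec x (1 / 2)); [exists (x + h) | exists (x - h)];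
    (split; [split; [split; lra | lra] |]);
    unfold Rdist; apply Rabs_def1; lra.
Qed.

Lemma D_in_I01_unique (f d d' : R -> R) (x : R) :
  I01 x -> D_in f d I01 x -> D_in f d' I01 x -> d x = d' x.
Proof. intros Hx. apply single_limit, adhDa_I01, Hx. Qed.

(** * Critical points, bounds and unimodality *)

(** On [x >= 0] the function [g (mu * x)] is nonnegative and increasing, so its square increases; it
    enters [fmu_d1] with the negative factor [Theta * mu / 2]. *)
Lemma fmu_d1_decreasing (Theta mu x y : R) :
  Theta < 0 -> 0 < mu -> 0 <= x -> x < y ->
  fmu_d1 Theta mu y < fmu_d1 Theta mu x.
Proof.
  intros HT Hmu Hx Hxy. unfold fmu_d1.
  assert (0 <= g (mu * x)) by (apply g_nonneg; nra).
  assert (g (mu * x) < g (mu * y)) by (apply g_increasing; nra).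
  assert (0 < mu * (g (mu * y) ^ 2 - g (mu * x) ^ 2)) by (apply Rmult_lt_0_compat; nra).
  nra.
Qed.

Lemma critical_point_fmu_d1 (Theta mu c : R) :
  critical_point (fmu Theta mu) c <-> I01 c /\ fmu_d1 Theta mu c = 0.
Proof.
  split; intros [Hc Hd]; (split; [exact Hc|]).
  - refine (D_in_I01_unique _ _ (fun _ => 0) c Hc _ Hd).
    apply is_derive_D_in, is_derive_fmu.
  - apply is_derive_D_in. rewrite <- Hd. apply is_derive_fmu.
Qed.

Lemma critical_point_fmu_unique (Theta mu c c' : R) :
  Theta < 0 -> 0 < mu ->
  critical_point (fmu Theta mu) c -> critical_point (fmu Theta mu) c' -> c' = c.
Proof.
  intros HT Hmu [[Hc0 _] Hc]%critical_point_fmu_d1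
    [[Hc0' _] Hc']%critical_point_fmu_d1.
  destruct (Rtotal_order c' c) as [H | [H | H]]; [| exact H |];
    apply (fmu_d1_decreasing Theta mu) in H; lra.
Qed.

Lemma fmu_at_0 (Theta mu : R) : fmu Theta mu 0 = 0.
Proof. rewrite fmu_g, Rmult_0_r, g_0. ring. Qed.

Lemma fmu_at_1 (Theta mu : R) : fmu Theta mu 1 = 0.
Proof. rewrite fmu_g, Rmult_1_r. ring. Qed.

Lemma fmu_mu0 (Theta x : R) : fmu Theta 0 x = 0.
Proof. rewrite fmu_g, Rmult_0_l, g_0. ring. Qed.

(** The derivative of [g (m * x) - x * g m] in [m] is [x / 2 * (g m ^ 2 - g (m * x) ^ 2)],
    nonnegative because [0 <= m * x <= m]. *)
Lemma fmu_mu_nondecreasing (Theta mu nu x : R) :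
  Theta < 0 -> 0 <= mu -> mu <= nu -> I01 x ->
  fmu Theta mu x <= fmu Theta nu x.
Proof.
  intros HT Hmu [Hlt | ->] [Hx0 Hx1]; [| apply Rle_refl].
  destruct (MVT_cor2 (fun m => g (m * x) - x * g m)
    (fun m => x / 2 * (g m ^ 2 - g (m * x) ^ 2)) mu nu Hlt) as [z [Hz [Hz0 _]]].
  { intros z _. apply is_derive_Reals.
    auto_derive; [repeat split; apply ex_derive_g | rewrite !Derive_g; field]. }
  assert (0 <= g (z * x)) by (apply g_nonneg; nra).
  assert (g (z * x) <= g z) by (apply g_nondecreasing; nra).
  assert (0 <= x / 2 * (g z ^ 2 - g (z * x) ^ 2) * (nu - mu)).
  { apply Rmult_le_pos; [apply Rmult_le_pos; nra | lra]. }
  rewrite !fmu_g. apply Rmult_le_compat_l; lra.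
Qed.

(** The decreasing derivative vanishes at [c], hence is positive before [c] and negative after
    it. *)
Lemma fmu_le_max (Theta mu c x : R) :
  Theta < 0 -> 0 < mu -> critical_point (fmu Theta mu) c -> I01 x ->
  fmu Theta mu x <= fmu Theta mu c.
Proof.
  intros HT Hmu [[Hc0 _] Hc]%critical_point_fmu_d1 [Hx0 _].
  destruct (Rtotal_order x c) as [H | [-> | H]]; [| apply Rle_refl |];
    destruct (MVT_cor2 (fmu Theta mu) (fmu_d1 Theta mu) _ _ H) as [z [Hz [Hz1 Hz2]]];
    try (intros z _; apply is_derive_Reals, is_derive_fmu).
  - pose proof (fmu_d1_decreasing Theta mu z c HT Hmu ltac:(lra) Hz2). nra.
  - pose proof (fmu_d1_decreasing Theta mu c z HT Hmu ltac:(lra) Hz1). nra.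
Qed.

Lemma fmu_unimodal (Theta mu : R) :
  Theta < 0 -> 0 < mu -> maps_I (fmu Theta mu) -> unimodal (fmu Theta mu).
Proof.
  intros HT Hmu Hmaps. split; [exact Hmaps|].
  split.
  { intros x _. exists (fmu_d1 Theta mu x).
    apply is_derive_D_in, is_derive_fmu. }
  split; [apply fmu_at_0|]. split; [apply fmu_at_1|].
  (* Rolle's argument: equal values at 0 and 1 give an interior critical point. *)
  destruct (MVT_cor2 (fmu Theta mu) (fmu_d1 Theta mu) 0 1 Rlt_0_1) as [c [Hc Hc01]].
  { intros z _. apply is_derive_Reals, is_derive_fmu. }
  rewrite fmu_at_0, fmu_at_1 in Hc.
  assert (critical_point (fmu Theta mu) c).
  { apply critical_point_fmu_d1. split; [split|]; lra. }
  exists c. split; [exact Hc01|]. split; [assumption|].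
  intros c' Hc'. apply (critical_point_fmu_unique Theta mu); assumption.
Qed.

(** * Negative Schwarzian derivative *)

Lemma schwarzian_neg (d1 d2 d3 : R -> R) (x : R) :
  d1 x <> 0 -> d1 x * d3 x - 3 / 2 * d2 x ^ 2 < 0 ->
  schwarzian d1 d2 d3 x < 0.
Proof.
  intros Hd H. unfold schwarzian.
  replace (d3 x / d1 x - 3 / 2 * (d2 x / d1 x) ^ 2)
    with ((d1 x * d3 x - 3 / 2 * d2 x ^ 2) / d1 x ^ 2) by (field; exact Hd).
  apply Rdiv_neg_pos; [exact H|]. apply pow2_gt_0, Hd.
Qed.

Lemma fmu_negative_schwarzian (Theta mu : R) :
  Theta < 0 -> 0 < mu -> negative_schwarzian (fmu Theta mu).
Proof.
  intros HT Hmu.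
  exists (fmu_d1 Theta mu), (fmu_d2 Theta mu), (fmu_d3 Theta mu).
  split; [intros; apply is_derive_D_in, is_derive_fmu|].
  split; [intros; apply is_derive_D_in, is_derive_fmu_d1|].
  split; [intros; apply is_derive_D_in, is_derive_fmu_d2|].
  intros x _ Hd. apply schwarzian_neg; [exact Hd|]. clear Hd.
  unfold fmu_d1, fmu_d2, fmu_d3.
  pose proof (g_pos mu Hmu) as Hk0. pose proof (g_lt_half mu Hmu) as Hk1.
  pose proof (g_gt_m1 (mu * x)). pose proof (g_lt_1 (mu * x)).
  (* Here [k] is [g mu] itself, without the factor [2 / mu] of the overview. *)
  set (t := g (mu * x)) in *. set (k := g mu) in *.
  assert (Hs : 0 < 1 - t ^ 2) by nra.
  (* This is [mu] times the affine bracket of the overview, written as the convex combination of its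
     endpoint values with weights [1 - t ^ 2] and [t ^ 2]. *)
  assert (Hb : 0 < (mu - 2 * k) * (1 - t ^ 2) + 4 * k * t ^ 2).
  { apply Rplus_lt_le_0_compat; [apply Rmult_lt_0_compat; lra | nra]. }
  match goal with |- ?e < 0 =>
    replace e with (- (Theta ^ 2 * mu ^ 3 * (1 - t ^ 2)
      * ((mu - 2 * k) * (1 - t ^ 2) + 4 * k * t ^ 2) / 8)) by field
  end.
  assert (0 < Theta ^ 2) by (apply pow2_gt_0; lra).
  assert (0 < mu ^ 3) by (apply pow_lt, Hmu).
  apply Ropp_lt_gt_0_contravar, Rdiv_lt_0_compat; [| lra].
  repeat first [assumption | apply Rmult_lt_0_compat].
Qed.

(** * Kneading sequence and conclusion *)

(** The orbit of [f c] is 1, 0, 0, ..., where 1 lies right of [c] and the fixed point 0 lies left of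
    it. *)
Lemma kneading_one_then_zeros (f : R -> R) (c : R) :
  0 < c < 1 -> f c = 1 -> f 1 = 0 -> f 0 = 0 ->
  forall j, kneading f c j = one_then_zeros j.
Proof.
  intros Hc Hfc Hf1 Hf0 j. unfold kneading, itinerary. rewrite Hfc.
  destruct j as [| j]; simpl.
  - destruct (Rlt_dec 1 c); [lra|]. destruct (Rlt_dec c 1); [reflexivity | lra].
  - assert (f (Nat.iter j f 1) = 0) as ->.
    { induction j as [| j IH]; simpl; [exact Hf1 | rewrite IH; exact Hf0]. }
    destruct (Rlt_dec 0 c); [reflexivity | lra].
Qed.

Theorem theorem11 (Theta mu1 c : R)
  (hTheta : Theta < 0) (hmu1 : 0 < mu1)
  (hc : 0 < c < 1) (hcrit : critical_point (fmu Theta mu1) c)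
  (hmax : fmu Theta mu1 c = 1) :
  full_S_unimodal_family (fmu Theta) 0 mu1.
Proof.
  assert (Hmaps : forall mu, 0 <= mu <= mu1 -> maps_I (fmu Theta mu)).
  { intros mu [Hmu0 Hmu1] x Hx. split.
    (* The lower bound 0 is read as the value at parameter 0, the upper bound 1 as the maximum at
       [mu1]. *)
    - rewrite <- (fmu_mu0 Theta x).
      apply fmu_mu_nondecreasing; auto; lra.
    - rewrite <- hmax. apply Rle_trans with (fmu Theta mu1 x).
      + apply fmu_mu_nondecreasing; auto.
      + apply fmu_le_max; assumption. }
  split; [exact hmu1|]. split; [exact Hmaps|].
  split.
  { intros mu Hmu. apply fmu_unimodal; [exact hTheta | lra |].
    apply Hmaps; lra. }
  split; [intros x _; apply fmu_mu0|].
  split.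
  { intros c' Hc'.
    (* The kneading condition ranges over all critical points; uniqueness leaves only the given
       [c]. *)
    rewrite (critical_point_fmu_unique Theta mu1 c c'); auto.
    apply kneading_one_then_zeros; auto using fmu_at_0, fmu_at_1. }
  intros mu Hmu. apply fmu_negative_schwarzian; lra.
Qed.
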